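(* Let $0<c_{\min}<c_{\max}<\infty$ and let $0<q\le\frac{c_{\max}-c_{\min}}{c_{\max}+c_{\min}}$ be fixed. For any $n\in\mathbb N$, $n\ge1$, there exist a frequency $\omega>0$ and a piecewise constant wave speed $c$ with $n$ jumps and values in $[c_{\min},c_{\max}]$ such that $c$ and $\omega$ are in localisation interference and $n\sim\omega$ (i.e. $\omega/n$ is bounded above and below by positive constants independent of $n$), and as a consequence, for $1\le\ell\le n$, $$\left|\left(\mathbf M_0^{\mathrm{Green}}\right)_{2\ell-1,2n}\right|=\left(\frac{1+q}{1-q}\right)^{\lceil n/2\rceil-\lfloor \ell/2\rfloor}.$$
   Context: Dimension $d=3$. A piecewise constant wave speed with $n$ jumps is given by points $0=x_0<x_1<\dots<x_{n+1}=1$ and positive values $c_1,\dots,c_{n+1}$, via $c(\mathbf x)=c_\ell$ for $|\mathbf x|\in(x_{\ell-1},x_\ell)$. Put $h_\ell=x_\ell-x_{\ell-1}$ and $q_\ell=\frac{c_{\ell+1}-c_\ell}{c_{\ell+1}+c_\ell}$ for $1\le\ell\le n$. Localisation interference: $c$ and $\omega$ are in localisation interference if $q_\ell=(-1)^{\ell-1}|q_\ell|$ for all $1\le\ell\le n$, $\min_{1\le\ell\le n}|q_\ell|\ge q_{\min}$ for some $q_{\min}>0$, and $e^{-\mathrm i\omega h_\ell/c_\ell}\in\{\mathrm i,-\mathrm i\}$ for all $1\le\ell\le n+1$. Green's operator (mode $m=0$): let $f_1(x)=h_0^{(1)}(x)=-\mathrm i e^{\mathrm i x}/x$, $f_2(x)=j_0(x)=\sin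 x/x$ and, for $p,s\in\{1,2\}$, with $z_\ell=\omega x_\ell$, $$w^{p,s}_{j,k,\ell}=\frac{f_p(z_\ell/c_j)f_s'(z_\ell/c_k)}{c_k}-\frac{f_p'(z_\ell/c_j)f_s(z_\ell/c_k)}{c_j}.$$ $\mathbf M_0^{\mathrm{Green}}$ is the inverse of the $2n\times2n$ block tridiagonal matrix with $2\times2$ diagonal blocks $\frac1{w^{2,1}_{\ell+1,\ell,\ell}}\begin{bmatrix}w^{2,2}_{\ell+1,\ell,\ell}&w^{1,2}_{\ell+1,\ell+1,\ell}\\-w^{1,2}_{\ell,\ell,\ell}&w^{1,1}_{\ell,\ell+1,\ell}\end{bmatrix}$ ($1\le\ell\le n$), blocks $\begin{bmatrix}0&1\\0&0\end{bmatrix}$ in positions $(\ell+1,\ell)$ and $\begin{bmatrix}0&0\\-1&0\end{bmatrix}$ in positions $(\ell,\ell+1)$ ($1\le\ell\le n-1$), and zero blocks elsewhere. *)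

(* Defs.v *)
From mathcomp Require Import all_boot all_order all_algebra.
From mathcomp Require Import complex.
From mathcomp Require Import all_classical all_reals all_analysis.
Set Implicit Arguments.
Unset Strict Implicit.
Unset Printing Implicit Defensive.
Import Order.TTheory GRing.Theory Num.Theory.
Import numFieldNormedType.Exports.
Local Open Scope ring_scope.
Local Open Scope complex_scope.

(* [knot l] is x_l for 0 <= l <= n+1 and [value l] is c_l for 1 <= l <= n+1;
   values of these sequences at other indices are irrelevant. *)
Record wave_speed (R : realType) (n : nat) := WaveSpeed {
  knot : nat -> R;
  value : nat -> R;
  knot_first : knot 0 = 0;
  knot_last : knot n.+1 = 1;
  knot_lt : forall l : nat, (l <= n)%N -> knot l < knot l.+1;
  value_gt0 : forall l : nat, (1 <= l <= n.+1)%N -> 0 < value l }.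

Definition layer_width (R : realType) (n : nat) (c : wave_speed R n) (l : nat) : R :=
  knot c l - knot c l.-1.

Definition jump (R : realType) (n : nat) (c : wave_speed R n) (l : nat) : R :=
  (value c l.+1 - value c l) / (value c l.+1 + value c l).

Definition expi (R : realType) (t : R) : R[i] := cos t +i* sin t.

Definition localisation_interference (R : realType) (n : nat) (qmin : R)
    (c : wave_speed R n) (omega : R) : Prop :=
  [/\ forall l : nat, (1 <= l <= n)%N -> jump c l = (-1) ^+ l.-1 * `|jump c l|,
      forall l : nat, (1 <= l <= n)%N -> qmin <= `|jump c l|
    & forall l : nat, (1 <= l <= n.+1)%N ->
        expi (- (omega * layer_width c l / value c l)) = 'i%C \/
        expi (- (omega * layer_width c l / value c l)) = - 'i%C].

Definition sph_hankel0 (R : realType) (x : R) : R[i] := - 'i%C * expi x / x%:C.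

Definition sph_bessel0 (R : realType) (x : R) : R[i] := (sin x / x)%:C.

Definition complex_derive1 (R : realType) (f : R -> R[i]) (x : R) : R[i] :=
  derive1 (fun t : R => complex.Re (f t)) x +i* derive1 (fun t : R => complex.Im (f t)) x.

(* [cross c omega f_p f_s j k l] is w^{p,s}_{j,k,l}, where f_1 is [sph_hankel0]
   and f_2 is [sph_bessel0]. *)
Definition cross (R : realType) (n : nat) (c : wave_speed R n) (omega : R)
    (f g : R -> R[i]) (j k l : nat) : R[i] :=
  let z := omega * knot c l in
  f (z / value c j) * complex_derive1 g (z / value c k) / (value c k)%:C
  - complex_derive1 f (z / value c j) * g (z / value c k) / (value c j)%:C.

Definition mx22 (T : Type) (a b c d : T) : 'M[T]_2 :=
  \matrix_(i < 2, j < 2)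
    if i == 0%N :> nat then (if j == 0%N :> nat then a else b)
    else (if j == 0%N :> nat then c else d).

Definition diag_block (R : realType) (n : nat) (c : wave_speed R n) (omega : R)
    (l : nat) : 'M[R[i]]_2 :=
  let f1 := @sph_hankel0 R in
  let f2 := @sph_bessel0 R in
  let w := cross c omega in
  (w f2 f1 l.+1 l l)^-1 *:
    mx22 (w f2 f2 l.+1 l l)    (w f1 f2 l.+1 l.+1 l)
         (- w f1 f2 l l l)     (w f1 f1 l l.+1 l).

(* The block in position (k, l), with 1 <= k, l <= n. *)
Definition system_block (R : realType) (n : nat) (c : wave_speed R n) (omega : R)
    (k l : nat) : 'M[R[i]]_2 :=
  if k == l then diag_block c omega l
  else if k == l.+1 then mx22 0 1 0 0
  else if l == k.+1 then mx22 0 0 (-1) 0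
  else 0.

Definition system_mx (R : realType) (n : nat) (c : wave_speed R n) (omega : R) :
    'M[R[i]]_(2 * n) :=
  \matrix_(r < 2 * n, s < 2 * n)
    system_block c omega (r %/ 2).+1 (s %/ 2).+1 (inord (r %% 2)) (inord (s %% 2)).

Definition green_mx (R : realType) (n : nat) (c : wave_speed R n) (omega : R) :
    'M[R[i]]_(2 * n) := invmx (system_mx c omega).

(* Main.v *)
(* Writing the mode-0 field in layer l as v_(l-1) h_0 + y_l j_0, the system says
   that field and radial derivative are continuous at the interfaces, with
   v_0 = 0 at the origin; the last column of its inverse is the solution with
   y_(n+1) = 1.  Such a field is s_l sin (t - b_l) / t in layer l, where
   t = omega r / c_l, and |y_l| = |s_l|, so after normalisation the entries to
   be computed are |s_l / s_(n+1)|.  When every layer is a quarter wavelength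
   thick, t - b_l can be taken equal to l pi / 2 on both sides of the l-th
   interface, and continuity reads c_l s_l = c_(l+1) s_(l+1) for odd l and
   s_l = s_(l+1) for even l.  With c alternating between cmin and rho cmin,
   rho = (1 + q) / (1 - q), this gives s_l = rho ^- (l./2). *)
Require Import Defs.
From mathcomp Require Import all_boot all_order all_algebra.
From mathcomp Require Import complex ring lra.
From mathcomp Require Import all_classical all_reals all_analysis.
Set Implicit Arguments.
Unset Strict Implicit.
Unset Printing Implicit Defensive.
Import Order.TTheory GRing.Theory Num.Theory.
Import numFieldNormedType.Exports.
Local Open Scope ring_scope.
Local Open Scope complex_scope.

(** * Componentwise derivatives of complex-valued functions of a real variable *)

Lemma Re_div_real (R : realType) (z : R[i]) (t : R) :
  complex.Re (z / t%:C) = complex.Re z / t.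
Proof. by rewrite -fmorphV; case: z => a b /=; rewrite mulr0 subr0. Qed.

Lemma Im_div_real (R : realType) (z : R[i]) (t : R) :
  complex.Im (z / t%:C) = complex.Im z / t.
Proof. by rewrite -fmorphV; case: z => a b /=; rewrite mulr0 add0r. Qed.

Lemma derive1_div_id (R : realType) (g : R -> R) (x : R) :
  x != 0 -> derivable g x 1 ->
  derive1 (fun t => g t / t) x = derive1 g x / x - g x / x ^+ 2.
Proof.
move=> x0 dg; rewrite !derive1E.
have di : derivable (@id R) x 1 by exact: derivable_id.
have dV := @derivableV R R^o id x 1 x0 di.
rewrite (deriveM dg dV) (deriveV x0 di) derive_id.
rewrite /GRing.scale /= mulr1 expr2.
rewrite addrC mulrC mulrN.
reflexivity.
Qed.

Lemma complex_derive1_div_id (R : realType) (u : R -> R[i]) (x : R) :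
  x != 0 ->
  derivable (fun t => complex.Re (u t)) x 1 ->
  derivable (fun t => complex.Im (u t)) x 1 ->
  complex_derive1 (fun t => u t / t%:C) x =
  complex_derive1 u x / x%:C - u x / x%:C ^+ 2.
Proof.
move=> x0 dr di; rewrite /complex_derive1 -rmorphXn.
have -> : (fun t => complex.Re (u t / t%:C)) = fun t => complex.Re (u t) / t.
  by apply/funext => t; rewrite Re_div_real.
have -> : (fun t => complex.Im (u t / t%:C)) = fun t => complex.Im (u t) / t.
  by apply/funext => t; rewrite Im_div_real.
rewrite (derive1_div_id x0 dr) (derive1_div_id x0 di).
have ReB : {morph @complex.Re R : a b / a - b} by case=> [? ?] [].
have ImB : {morph @complex.Im R : a b / a - b} by case=> [? ?] [].
apply/eqP; rewrite eq_complex ReB ImB !Re_div_real !Im_div_real.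
by rewrite !eqxx.
Qed.

(** Real and imaginary parts are separated through -i e^(it) = sin t - i cos t. *)
Lemma complex_derive1_hankel (R : realType) (x : R) :
  complex_derive1 (fun t => - 'i%C * expi t) x = expi x.
Proof.
rewrite /complex_derive1 /expi /=.
have -> : (fun t : R => - 0 * cos t - - 1 * sin t) = sin.
  by apply/funext => t; ring.
have -> : (fun t : R => - 0 * sin t + - 1 * cos t) = - cos.
  by apply/funext => t; rewrite fctE; ring.
rewrite !derive1E.
rewrite deriveN // !derive_val.
by rewrite opprK.
Qed.

Lemma complex_derive1_sin (R : realType) (x : R) :
  complex_derive1 (fun t : R => (sin t)%:C) x = (cos x)%:C.
Proof.
by rewrite /complex_derive1 /= derive1_cst derive1E derive_val.
Qed.

(** * The cross products w of the spherical functions *)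

Definition phase (R : realType) (n : nat) (c : wave_speed R n) (omega : R)
    (j l : nat) : R := omega * knot c l / value c j.

(** The terms [u x / x ^+ 2] and [v x / x ^+ 2] of the two derivatives contribute the same product
    of [u] and [v] to both halves of w and cancel. What remains involves only the numerators and
    their derivatives. *)
Lemma cross_div_id (R : realType) (n : nat) (c : wave_speed R n) (omega : R)
    (u u' v v' : R -> R[i]) (j k l : nat) :
  omega * knot c l != 0 -> value c j != 0 -> value c k != 0 ->
  (forall x, x != 0 -> complex_derive1 (fun t => u t / t%:C) x =
     u' x / x%:C - u x / x%:C ^+ 2) ->
  (forall x, x != 0 -> complex_derive1 (fun t => v t / t%:C) x =
     v' x / x%:C - v x / x%:C ^+ 2) ->
  cross c omega (fun t => u t / t%:C) (fun t => v t / t%:C) j k l =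
  ((value c j)%:C * u (phase c omega j l) * v' (phase c omega k l)
   - (value c k)%:C * u' (phase c omega j l) * v (phase c omega k l))
  / (omega * knot c l)%:C ^+ 2.
Proof.
rewrite /cross /phase; set z := omega * knot c l => z0 j0 k0 du dv.
have zj : z / value c j != 0 by rewrite mulf_neq0 ?invr_eq0.
have zk : z / value c k != 0 by rewrite mulf_neq0 ?invr_eq0.
rewrite (du _ zj) (dv _ zk) !(fmorph_div (real_complex R) z).
have zC : z%:C != 0 :> R[i] by rewrite fmorph_eq0.
have jC : (value c j)%:C != 0 :> R[i] by rewrite fmorph_eq0.
have kC : (value c k)%:C != 0 :> R[i] by rewrite fmorph_eq0.
by field; rewrite zC jC kC.
Qed.

(** Numerators of h_0 and j_0 over t. The derivative of [outgoing] is [expi], that of [standing] is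
    [standing']. *)
Definition outgoing (R : realType) (t : R) : R[i] := - 'i%C * expi t.
Definition standing (R : realType) (t : R) : R[i] := (sin t)%:C.
Definition standing' (R : realType) (t : R) : R[i] := (cos t)%:C.

Lemma complex_derive1_sph_hankel0 (R : realType) (x : R) : x != 0 ->
  complex_derive1 (fun t => outgoing t / t%:C) x =
  expi x / x%:C - outgoing x / x%:C ^+ 2.
Proof.
move=> x0; rewrite complex_derive1_div_id ?complex_derive1_hankel //.
Qed.

Lemma complex_derive1_sph_bessel0 (R : realType) (x : R) : x != 0 ->
  complex_derive1 (fun t => standing t / t%:C) x =
  standing' x / x%:C - standing x / x%:C ^+ 2.
Proof.
move=> x0; rewrite complex_derive1_div_id ?complex_derive1_sin //.
exact: derivable_cst.
Qed.

Lemma sph_bessel0E (R : realType) :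
  @sph_bessel0 R = fun t => standing t / t%:C.
Proof. by apply/funext => t; rewrite /sph_bessel0 fmorph_div. Qed.

(** * Row equations of the block tridiagonal system *)

Lemma sum_pairs (V : nmodType) (n : nat) (F : nat -> V) :
  \sum_(s < 2 * n) F s = \sum_(m < n) (F (2 * m)%N + F (2 * m).+1).
Proof.
elim: n => [|n IH]; first by rewrite !big_ord0.
by rewrite mulnS add2n !big_ord_recr /= IH addrA.
Qed.

(** The unknowns in the order y_1, v_1, y_2, v_2, ...: block l pairs the coefficient of j_0 in layer
    l with that of h_0 in layer l + 1. *)
Definition interleave (K : ringType) (n : nat) (y v : nat -> K) : 'cV[K]_(2 * n) :=
  \col_r if odd r then v (r./2).+1 else y (r./2).+1.

Lemma sum_if_eq (V : nmodType) (n k : nat) (a : V) :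
  \sum_(m < n) (if m == k :> nat then a else 0) = if (k < n)%N then a else 0.
Proof. by rewrite -big_mkcond (big_ord1_eq _ (fun=> a)). Qed.

(** The convention [v 0 = 0] gives the first block row, which has no left neighbour, the same form
    as the others. The last row lacks y_(n+1), since the matrix has no column for it; hence the test
    [l == n]. *)
Lemma system_mx_mul (R : realType) (n : nat) (c : wave_speed R n) (omega : R)
    (y v : nat -> R[i]) (r : 'I_(2 * n)) :
  let l := (r %/ 2)%N.+1 in
  let D i j := diag_block c omega l (inord i) (inord j) in
  v 0 = 0 ->
  (system_mx c omega *m interleave n y v) r 0 =
  if odd r then D 1%N 0%N * y l + D 1%N 1%N * v l - (if l == n then 0 else y l.+1)
  else D 0%N 0%N * y l + D 0%N 1%N * v l + v l.-1.
Proof.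
move=> l D v0; rewrite mxE.
pose B m := system_block c omega l m.+1 (inord (r %% 2)%N).
pose F s := B (s %/ 2)%N (inord (s %% 2)%N) * (if odd s then v s./2.+1 else y s./2.+1).
rewrite (eq_bigr (fun s : 'I_(2 * n) => F s)); last by move=> s _; rewrite !mxE.
rewrite sum_pairs.
have FE m : F (2 * m)%N + F (2 * m).+1 = B m (inord 0) * y m.+1 + B m (inord 1) * v m.+1.
  rewrite /F mul2n /= odd_double doubleK uphalf_double.
  have -> : (m.*2 %/ 2 = m)%N by rewrite divn2 doubleK.
  have -> : (m.*2.+1 %/ 2 = m)%N by rewrite divn2 /= uphalf_double.
  by rewrite !modn2 /= odd_double.
have ln : (r %/ 2 < n)%N by rewrite ltn_divLR // [(n * 2)%N]mulnC.
pose e := inord (r %% 2)%N : 'I_2.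
(* Each summand is split into its diagonal, left and right contributions, so that [sum_if_eq]
   collapses the sums one by one. In the first block row the truncated predecessor makes the left
   index coincide with the diagonal one; the extra term is then [v 0 = 0]. *)
have BE m : B m (inord 0) * y m.+1 + B m (inord 1) * v m.+1 =
  (if m == (r %/ 2)%N then diag_block c omega l e (inord 0) * y l
     + diag_block c omega l e (inord 1) * v l else 0)
  + (if m == (r %/ 2)%N.-1 then (if odd r then 0 else v l.-1) else 0)
  + (if m == l then (if odd r then - y l.+1 else 0) else 0).
  have ev0 : (inord 0 : 'I_2) = 0%N :> nat by rewrite inordK.
  have ev1 : (inord 1 : 'I_2) = 1%N :> nat by rewrite inordK.
  have eE : e = odd r :> nat by rewrite /e modn2 inordK //; case: (odd r).
  have lpred : l.-1 = (r %/ 2)%N by [].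
  rewrite /B /system_block -/e -/l; have [->|mr] := eqVneq m (r %/ 2)%N.
    rewrite !eqxx [in X in _ = _ + X]ltn_eqF // addr0; case: ifP; last by rewrite addr0.
    move=> E; have -> : l.-1 = 0%N.
      by move: E; rewrite lpred; case: (r %/ 2)%N => //= k; rewrite eqn_leq ltnn.
    by rewrite v0 if_same addr0.
  rewrite /l eqSS eq_sym (negbTE mr) add0r !eqSS.
  have [rm|rm] := eqVneq (r %/ 2)%N m.+1.
    rewrite rm /= !eqxx [in X in _ = _ + X]ltn_eqF // addr0 !mxE eE ev0 ev1 /=.
    by case: (odd r); rewrite /= ?mul0r ?mul1r ?add0r ?addr0.
  have -> : (m == (r %/ 2)%N.-1) = false.
    by apply/eqP => E; move: mr rm; rewrite E; case: (r %/ 2)%N => [|k] //= _; rewrite eqxx.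
  rewrite add0r; have [->|_] := eqVneq m (r %/ 2)%N.+1.
    rewrite !mxE eE ev0 ev1 /=.
    by case: (odd r); rewrite /= ?mul0r ?mulN1r ?add0r ?addr0.
  by rewrite !mxE !mul0r addr0.
under eq_bigr do rewrite FE BE.
rewrite !big_split /= !sum_if_eq.
rewrite ln (leq_ltn_trans (leq_pred _) ln).
rewrite /e modn2.
have -> : (l < n)%N = (l != n) by rewrite ltn_neqAle ln andbT.
by case: (odd r); case: (l == n); rewrite /= ?addr0 ?subr0.
Qed.

(** * Nonvanishing of the denominators, and continuity across an interface *)

Lemma norm_expi (R : realType) (t : R) : `|expi t| = 1.
Proof. by rewrite normc_def /= cos2Dsin2 sqrtr1. Qed.

Lemma expi_neq0 (R : realType) (t : R) : expi t != 0.
Proof. by rewrite -normr_gt0 norm_expi ltr01. Qed.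

Lemma knot_gt0 (R : realType) (n : nat) (c : wave_speed R n) (l : nat) :
  (1 <= l <= n.+1)%N -> 0 < knot c l.
Proof.
elim: l => // -[_ _|l IH /andP[_ ln]].
  by rewrite -(knot_first c) knot_lt.
by rewrite (lt_trans (IH _)) ?knot_lt //= ltnW.
Qed.

Lemma cross_antisym (R : realType) (n : nat) (c : wave_speed R n) (omega : R)
    (f g : R -> R[i]) (j k l : nat) :
  cross c omega f g j k l = - cross c omega g f k j l.
Proof. by rewrite /cross; ring. Qed.

(** With a and b the two phases, the numerator of w factors as e^(ib) (c_j sin a + i c_k cos a), and
    sin a and cos a have no common zero. *)
Lemma cross_bessel_hankel_neq0 (R : realType) (n : nat) (c : wave_speed R n)
    (omega : R) (j k l : nat) :
  omega * knot c l != 0 -> value c j != 0 -> value c k != 0 ->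
  cross c omega (@sph_bessel0 R) (@sph_hankel0 R) j k l != 0.
Proof.
move=> z0 j0 k0.
rewrite sph_bessel0E (@cross_div_id _ _ _ _ (@standing R) (@standing' R)
  (@outgoing R) (@expi R)) //; last 2 first.
- exact: complex_derive1_sph_bessel0.
- exact: complex_derive1_sph_hankel0.
rewrite mulf_neq0 ?invr_eq0 ?expf_eq0 ?fmorph_eq0 //=.
set a := phase c omega j l; set b := phase c omega k l.
have -> : (value c j)%:C * standing a * expi b - (value c k)%:C * standing' a * outgoing b
  = expi b * ((value c j * sin a) +i* (value c k * cos a)).
  rewrite [in RHS](complexE (_ +i* _)) /complex.Re /complex.Im !rmorphM.
  rewrite /outgoing /standing /standing'.
  move: (expi b) => E. ring.
rewrite mulf_neq0 ?expi_neq0 // eq_complex /= !mulf_eq0 (negbTE j0) (negbTE k0) /=.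
apply/negP => /andP[/eqP sa /eqP ca].
by have := cos2Dsin2 a; rewrite sa ca !expr0n /= addr0 => /esym/eqP; rewrite oner_eq0.
Qed.

Lemma diag_blockE (R : realType) (n : nat) (c : wave_speed R n) (omega : R) (l : nat) :
  let f1 := @sph_hankel0 R in
  let f2 := @sph_bessel0 R in
  let w := cross c omega in
  let D i j := diag_block c omega l (inord i) (inord j) in
  [/\ D 0%N 0%N = (w f2 f1 l.+1 l l)^-1 * w f2 f2 l.+1 l l,
      D 0%N 1%N = (w f2 f1 l.+1 l l)^-1 * w f1 f2 l.+1 l.+1 l,
      D 1%N 0%N = (w f2 f1 l.+1 l l)^-1 * - w f1 f2 l l l &
      D 1%N 1%N = (w f2 f1 l.+1 l l)^-1 * w f1 f1 l l.+1 l].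
Proof. by split; rewrite !mxE !inordK. Qed.

(** By antisymmetry this entry is, up to sign, a quotient of two nonzero w. It is the pivot that
    lets the first row at interface l determine v_l. *)
Lemma diag_block01_neq0 (R : realType) (n : nat) (c : wave_speed R n) (omega : R)
    (l : nat) :
  0 < omega -> (1 <= l <= n)%N ->
  diag_block c omega l (inord 0) (inord 1) != 0.
Proof.
move=> w0 /andP[l1 ln].
have z0 : omega * knot c l != 0 by rewrite mulf_neq0 ?gt_eqF ?knot_gt0 // l1 leqW.
have c0 : value c l != 0 by rewrite gt_eqF ?value_gt0 // l1 leqW.
have c'0 : value c l.+1 != 0 by rewrite gt_eqF ?value_gt0.
have [_ -> _ _] := diag_blockE c omega l.
rewrite [X in _ * X]cross_antisym mulf_neq0 ?invr_eq0 ?oppr_eq0 //.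
  exact: cross_bessel_hankel_neq0.
exact: cross_bessel_hankel_neq0.
Qed.

(** The first hypothesis is continuity of the field multiplied by omega x_l; given it, continuity of
    the radial derivative reduces to the second. Pairing the two with j_0 of layer l + 1 eliminates
    [y'] and gives the first row; pairing with h_0 of layer l eliminates [v] and gives the
    second. *)
Lemma transfer_rows (R : realType) (n : nat) (c : wave_speed R n) (omega : R)
    (l : nat) (y v y' v' : R[i]) :
  let D i j := diag_block c omega l (inord i) (inord j) in
  let a := phase c omega l l in
  let b := phase c omega l.+1 l in
  0 < omega -> (1 <= l <= n)%N ->
  (value c l)%:C * (v * outgoing a + y * standing a) =
    (value c l.+1)%:C * (v' * outgoing b + y' * standing b) ->
  v * expi a + y * standing' a = v' * expi b + y' * standing' b ->
  D 0%N 0%N * y + D 0%N 1%N * v' + v = 0 /\ D 1%N 0%N * y + D 1%N 1%N * v' - y' = 0.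
Proof.
move=> D a b w0 /andP[l1 ln] H0 H1.
have z0 : omega * knot c l != 0 by rewrite mulf_neq0 ?gt_eqF ?knot_gt0 // l1 leqW.
have c0 : value c l != 0 by rewrite gt_eqF ?value_gt0 // l1 leqW.
have c'0 : value c l.+1 != 0 by rewrite gt_eqF ?value_gt0.
have [D00 D01 D10 D11] := diag_blockE c omega l.
rewrite /D D00 D01 D10 D11 {D D00 D01 D10 D11}.
have := cross_bessel_hankel_neq0 z0 c'0 c0.
have Eh := @complex_derive1_sph_hankel0 R.
have Eb := @complex_derive1_sph_bessel0 R.
rewrite sph_bessel0E.
rewrite !(cross_div_id z0 _ _ Eh Eh, cross_div_id z0 _ _ Eh Eb) //.
rewrite !(cross_div_id z0 _ _ Eb Eh, cross_div_id z0 _ _ Eb Eb) // -/a -/b.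
have : (omega * knot c l)%:C != 0 :> R[i] by rewrite fmorph_eq0.
move: (_)%:C H0 => cl H0; move: ((_ l.+1)%:C) H0 => cl' H0.
set z := (omega * knot c l)%:C.
move: z (standing a) (standing b) (standing' a) (standing' b)
  (outgoing a) (outgoing b) (expi a) (expi b) H0 H1.
move=> z sa sb sa' sb' oa ob oa' ob' H0 H1 zn0.
rewrite mulf_eq0 negb_or => /andP[w21 _].
split.
  apply: (mulfI w21); rewrite mulr0.
  transitivity (cl' * sb * (v * oa' + y * sa') - sb' * (cl * (v * oa + y * sa))
    + v' * (cl' * ob * sb' - cl' * ob' * sb)); first by field; rewrite w21 zn0.
  by rewrite H0 H1; ring.
apply: (mulfI w21); rewrite mulr0.
transitivity (cl * oa * (v' * ob' + y' * sb') - oa' * (cl' * (v' * ob + y' * sb))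
  - y * (cl * oa * sa' - cl * oa' * sa)); first by field; rewrite w21 zn0.
by rewrite -H0 -H1; ring.
Qed.

(** * Phase-shifted sine fields *)

(** The identity is sin (t - b) = e^(ib) sin t - sin b e^(it). The coefficient e^(ib) of [standing]
    has modulus 1, so phase shifts do not affect the size of y_l. *)
Lemma phase_shift_sin (R : realType) (t b : R) :
  (- 'i%C * (sin b)%:C) * outgoing t + expi b * standing t = (sin (t - b))%:C.
Proof.
rewrite sinB; apply/eqP; rewrite eq_complex /=; apply/andP.
by split; apply/eqP; ring.
Qed.

Lemma phase_shift_cos (R : realType) (t b : R) :
  (- 'i%C * (sin b)%:C) * expi t + expi b * standing' t = (cos (t - b))%:C.
Proof.
rewrite cosB; apply/eqP; rewrite eq_complex /=; apply/andP.
by split; apply/eqP; ring.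
Qed.

(* With the field s_l sin (t - b_l) / t in layer l, [amplitude] is y_l, the
   coefficient of j_0 in layer l, and [amplitude_out] is v_l, the coefficient
   of h_0 in layer l + 1. *)
Definition amplitude (R : realType) (s b : nat -> R) (l : nat) : R[i] :=
  (s l)%:C * expi (b l).

Definition amplitude_out (R : realType) (s b : nat -> R) (l : nat) : R[i] :=
  (s l.+1)%:C * (- 'i%C * (sin (b l.+1))%:C).

(** Continuity of the fields s_l sin (t - b_l) / t and of their radial derivatives, in the reduced
    form of [transfer_rows]. *)
Definition matched (R : realType) (n : nat) (c : wave_speed R n) (omega : R)
    (s b : nat -> R) : Prop :=
  forall l : nat, (1 <= l <= n)%N ->
  value c l * (s l * sin (phase c omega l l - b l)) =
    value c l.+1 * (s l.+1 * sin (phase c omega l.+1 l - b l.+1)) /\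
  s l * cos (phase c omega l l - b l) =
    s l.+1 * cos (phase c omega l.+1 l - b l.+1).

Lemma matched_rows (R : realType) (n : nat) (c : wave_speed R n) (omega : R)
    (s b : nat -> R) (l : nat) :
  let D i j := diag_block c omega l (inord i) (inord j) in
  let Y := amplitude s b in
  let V := amplitude_out s b in
  0 < omega -> matched c omega s b -> (1 <= l <= n)%N ->
  D 0%N 0%N * Y l + D 0%N 1%N * V l + V l.-1 = 0 /\
  D 1%N 0%N * Y l + D 1%N 1%N * V l - Y l.+1 = 0.
Proof.
move=> D Y V w0 sb ln; have [Hs Hc] := sb l ln.
have l1 : l.-1.+1 = l by case/andP: ln => l1 _; rewrite prednK.
have sE k t : V k * outgoing t + Y k.+1 * standing t =
    (s k.+1 * sin (t - b k.+1))%:C.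
  by rewrite /V /Y -!mulrA -mulrDr mulrA phase_shift_sin rmorphM.
have cE k t : V k * expi t + Y k.+1 * standing' t =
    (s k.+1 * cos (t - b k.+1))%:C.
  by rewrite /V /Y -!mulrA -mulrDr mulrA phase_shift_cos rmorphM.
have := cE l.-1; have := sE l.-1; rewrite l1 => sE' cE'.
apply: transfer_rows => //; first by rewrite sE' sE -!rmorphM Hs.
by rewrite cE' cE Hc.
Qed.

(** * Invertibility of the system and the last column of its inverse *)

(** The rows, read outwards from the origin, determine a kernel vector from y_1, so it is y_1 times
    the matched solution. Its y_(n+1) is zero while that of the matched solution is not, which
    forces y_1 = 0. *)
Lemma system_mx_unit (R : realType) (n : nat) (c : wave_speed R n) (omega : R)
    (s b : nat -> R) :
  0 < omega -> matched c omega s b -> b 1%N = 0 -> s 1%N = 1 -> s n.+1 != 0 ->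
  system_mx c omega \in unitmx.
Proof.
move=> w0 sb b1 s1 sn.
pose Y := amplitude s b; pose V := amplitude_out s b.
have Y1 : Y 1%N = 1 by rewrite /Y /amplitude b1 s1 mul1r /expi cos0 sin0.
have V0 : V 0%N = 0 by rewrite /V /amplitude_out b1 sin0 !mulr0.
have Yn : Y n.+1 != 0 by rewrite /Y /amplitude mulf_neq0 ?fmorph_eq0 ?expi_neq0.
(* [det0P] yields a row vector in a left kernel, hence the passage to the transpose. *)
rewrite -unitmx_tr unitmxE unitfE; apply/det0P => -[u u0 uM].
(* Extension by zero outside the index range makes y_(n+1) = 0, which stands for the missing
   column. *)
pose x k := if insub k is Some i then u 0 i else 0.
pose y l := x l.-1.*2; pose v l := if l is k.+1 then x k.*2.+1 else 0.
have uE : u^T = interleave n y v.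
  apply/colP => r; rewrite !mxE /y /v /=.
  have xr : x r = u 0 r by rewrite /x valK.
  rewrite -xr -[in LHS](odd_double_half r).
  by case: (odd r); rewrite ?add1n ?add0n.
have Mu : system_mx c omega *m interleave n y v = 0.
  by rewrite -uE -[_ *m _]trmxK trmx_mul trmxK uM trmx0.
have M0 r : (system_mx c omega *m interleave n y v) r 0 = 0 by rewrite Mu mxE.
have yn : y n.+1 = 0 by rewrite /y /x insubF // mul2n ltnn.
have rows k (kn : (k < n)%N) :
  let D i j := diag_block c omega k.+1 (inord i) (inord j) in
  D 0%N 0%N * y k.+1 + D 0%N 1%N * v k.+1 + v k = 0 /\
  D 1%N 0%N * y k.+1 + D 1%N 1%N * v k.+1 - y k.+2 = 0.
  have r0 : (k.*2 < 2 * n)%N by rewrite mul2n ltn_double.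
  have r1 : (k.*2.+1 < 2 * n)%N by rewrite mul2n ltn_Sdouble.
  have := system_mx_mul c omega y (v := v) (Ordinal r0) erefl.
  have := system_mx_mul c omega y (v := v) (Ordinal r1) erefl.
  rewrite !M0 /= odd_double /= !divn2 /= uphalf_double doubleK => E1 E0.
  split; first exact: esym E0.
  by rewrite [RHS]E1; case: eqP => // kE; rewrite -yn -[in y n.+1]kE.
have prop k : (k <= n)%N -> v k = y 1%N * V k /\ y k.+1 = y 1%N * Y k.+1.
  elim: k => [_|k IH kn]; first by rewrite V0 Y1 mulr0 mulr1.
  have [vk yk] := IH (ltnW kn).
  have [R0 R1] := rows k kn.
  have [Q0 Q1] := matched_rows w0 sb (kn : (1 <= k.+1 <= n)%N).
  have D01 := diag_block01_neq0 c w0 (kn : (1 <= k.+1 <= n)%N).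
  rewrite -/Y -/V /= in Q0 Q1.
  have vS : v k.+1 = y 1%N * V k.+1.
    apply: (mulfI D01); apply/eqP; rewrite -subr_eq0; apply/eqP.
    transitivity (0 - y 1%N * 0); last by rewrite mulr0 subr0.
    by rewrite -{1}R0 -Q0 vk yk; ring.
  split=> //; apply/eqP; rewrite -subr_eq0 -oppr_eq0; apply/eqP.
  transitivity (0 - y 1%N * 0); last by rewrite mulr0 subr0.
  by rewrite -{1}R1 -Q1 vS yk; ring.
have y1 : y 1%N = 0.
  have [_] := prop n (leqnn n); rewrite yn => /esym/eqP.
  by rewrite mulf_eq0 (negbTE Yn) orbF => /eqP.
apply/negP: u0; rewrite negbK -trmx_eq0 uE; apply/eqP/colP => r; rewrite !mxE.
have rn : (r./2 < n)%N by rewrite -divn2 ltn_divLR // [(n * 2)%N]mulnC.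
have [vr _] := prop _ rn; have [_ yr] := prop _ (ltnW rn).
by rewrite vr yr y1 !mul0r if_same.
Qed.

(** The matched solution satisfies every row except the last, where the absent term leaves y_(n+1)
    on the right. Divided by y_(n+1) it is therefore the last column of the inverse, and |y_l| =
    |s_l|. *)
Lemma green_mx_last_col (R : realType) (n : nat) (c : wave_speed R n) (omega : R)
    (s b : nat -> R) (l : nat) (i j : 'I_(2 * n)) :
  0 < omega -> matched c omega s b -> b 1%N = 0 -> s 1%N = 1 -> s n.+1 != 0 ->
  (1 <= l <= n)%N -> i = l.-1.*2 :> nat -> j.+1 = (2 * n)%N ->
  `|green_mx c omega i j| = (`|s l / s n.+1|)%:C.
Proof.
move=> w0 sb b1 s1 sn ln il jn.
have U := system_mx_unit w0 sb b1 s1 sn.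
pose Y := amplitude s b; pose V := amplitude_out s b.
have V0 : V 0%N = 0 by rewrite /V /amplitude_out b1 sin0 !mulr0.
have Yn : Y n.+1 != 0 by rewrite /Y /amplitude mulf_neq0 ?fmorph_eq0 ?expi_neq0.
have jn2 : j.+1 = n.*2 by rewrite jn mul2n.
have MX : system_mx c omega *m interleave n Y V = Y n.+1 *: delta_mx j 0.
  apply/colP => r; rewrite system_mx_mul // [RHS]mxE [in RHS]mxE andbT.
  have rn : (r %/ 2 < n)%N by rewrite ltn_divLR // [(n * 2)%N]mulnC.
  have [R0 R1] := matched_rows w0 sb (rn : (1 <= (r %/ 2)%N.+1 <= n)%N).
  rewrite -/Y -/V /= in R0 R1.
  have -> : (r == j) = odd r && ((r %/ 2)%N.+1 == n).
    rewrite -val_eqE /= -eqSS jn2 divn2 -{1}(odd_double_half r).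
    case: (odd r); rewrite ?add1n ?add0n -?doubleS ?(inj_eq double_inj) //=.
    by apply/eqP => /(congr1 odd); rewrite /= !odd_double.
  case: (odd r) => /=; last by rewrite R0 mulr0.
  case: eqP => [rE|_]; last by rewrite R1 mulr0.
  by rewrite mulr1 subr0; rewrite -[in Y n.+1]rE; apply/eqP; rewrite -subr_eq0 R1.
have := congr1 (fun A : 'cV[R[i]]_(2 * n) => A i 0) (mulKmx U (interleave n Y V)).
rewrite MX -scalemxAr -colE !mxE -/(green_mx c omega) il odd_double doubleK.
have -> : l.-1.+1 = l by case/andP: ln => l1 _; rewrite prednK.
move=> E; have -> : green_mx c omega i j = Y l / Y n.+1.
  by rewrite -E mulrC mulKf.
have nE k : `|Y k| = (`|s k|)%:C.
  rewrite /Y /amplitude normrM norm_expi mulr1 normc_def /=.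
  by rewrite expr0n /= addr0 sqrtr_sqr.
by rewrite normf_div !nE -fmorph_div normf_div.
Qed.

(** * Wave speeds whose layers are all a quarter wavelength thick *)

Definition travel (R : realType) (w : nat -> R) (l : nat) : R :=
  \sum_(k < l) w k.+1.

Lemma travelS (R : realType) (w : nat -> R) (l : nat) :
  travel w l.+1 = travel w l + w l.+1.
Proof. exact: big_ord_recr. Qed.

Lemma travel_gt0 (R : realType) (w : nat -> R) (n : nat) :
  (forall l, 0 < w l) -> 0 < travel w n.+1.
Proof.
move=> w0; rewrite travelS ltr_wpDl //.
by apply: sumr_ge0 => k _; rewrite ltW.
Qed.

Lemma travel_bounds (R : realType) (w : nat -> R) (a b : R) (n : nat) :
  (forall l, a <= w l <= b) -> a * n%:R <= travel w n <= b * n%:R.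
Proof.
move=> wab; elim: n => [|n /andP[IHa IHb]].
  by rewrite /travel big_ord0 !mulr0 lexx.
have /andP[wa wb] := wab n.+1.
by rewrite travelS -natr1 !mulrDr !mulr1 !lerD.
Qed.

Lemma travel_knot_first (R : realType) (n : nat) (w : nat -> R) :
  travel w 0 / travel w n.+1 = 0.
Proof. by rewrite /travel big_ord0 mul0r. Qed.

Lemma travel_knot_last (R : realType) (n : nat) (w : nat -> R)
  (w0 : forall l, 0 < w l) : travel w n.+1 / travel w n.+1 = 1.
Proof. by rewrite divff // gt_eqF ?travel_gt0. Qed.

Lemma travel_knot_lt (R : realType) (n : nat) (w : nat -> R)
  (w0 : forall l, 0 < w l) (l : nat) :
  (l <= n)%N -> travel w l / travel w n.+1 < travel w l.+1 / travel w n.+1.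
Proof. by move=> _; rewrite ltr_pM2r ?invr_gt0 ?travel_gt0 // travelS ltrDl. Qed.

(** Widths are proportional to speeds, so every layer is crossed in the same time; the division by
    the total normalises x_(n+1) to 1. *)
Definition quarter_wave (R : realType) (n : nat) (w : nat -> R)
    (w0 : forall l, 0 < w l) : wave_speed R n :=
  @WaveSpeed R n (fun l => travel w l / travel w n.+1) w
    (travel_knot_first n w) (travel_knot_last n w0) (travel_knot_lt w0)
    (fun l _ => w0 l).

Definition quarter_frequency (R : realType) (n : nat) (w : nat -> R) : R :=
  pi / 2 * travel w n.+1.

Lemma quarter_wave_phase (R : realType) (n : nat) (w : nat -> R)
    (w0 : forall l, 0 < w l) (j l : nat) :
  phase (quarter_wave n w0) (quarter_frequency n w) j l = pi / 2 * travel w l / w j.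
Proof.
have tn : travel w n.+1 != 0 by rewrite gt_eqF ?travel_gt0.
have wj : w j != 0 by rewrite gt_eqF.
by rewrite /phase /quarter_frequency /=; field; rewrite tn wj.
Qed.

Lemma quarter_wave_layer (R : realType) (n : nat) (w : nat -> R)
    (w0 : forall l, 0 < w l) (l : nat) : (0 < l)%N ->
  quarter_frequency n w * layer_width (quarter_wave n w0) l / w l = pi / 2.
Proof.
case: l => // l _; have tn : travel w n.+1 != 0 by rewrite gt_eqF ?travel_gt0.
have wj : w l.+1 != 0 by rewrite gt_eqF.
rewrite /quarter_frequency /layer_width /= (travelS w l).
by field; rewrite tn wj.
Qed.

(** A quarter turn exchanges sine and cosine up to sign, which carries the induction. At each
    interface one of the two matching conditions thus becomes 0 = 0. *)
Lemma quarter_turn_zero (R : realType) (l : nat) :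
  (if odd l then cos (l%:R * (pi / 2)) else sin (l%:R * (pi / 2))) = 0 :> R.
Proof.
elim: l => [|l IH]; first by rewrite mul0r sin0.
rewrite -natr1 mulrDl mul1r cosDpihalf sinDpihalf /=.
by move: IH; case: (odd l) => //= ->; rewrite oppr0.
Qed.

(** The shift b_l is the phase at the inner end of layer l minus (l - 1) pi / 2. Since t grows by pi
    / 2 across the layer, t - b_l equals l pi / 2 at its outer end, in agreement with layer l + 1.
    Only the sine condition survives for odd l, only the cosine condition for even l. *)
Lemma quarter_wave_matched (R : realType) (n : nat) (w s : nat -> R)
    (w0 : forall l, 0 < w l) :
  (forall l, odd l -> w l * s l = w l.+1 * s l.+1) ->
  (forall l, ~~ odd l -> s l = s l.+1) ->
  matched (quarter_wave n w0) (quarter_frequency n w) s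
    (fun l => pi / 2 * travel w l.-1 / w l - pi / 2 * l.-1%:R).
Proof.
move=> sodd seven [//|l] _; rewrite !quarter_wave_phase /=.
have wl : w l.+1 != 0 by rewrite gt_eqF.
have wl' : w l.+2 != 0 by rewrite gt_eqF.
have -> : pi / 2 * travel w l.+1 / w l.+1 -
    (pi / 2 * travel w l / w l.+1 - pi / 2 * l%:R) = l.+1%:R * (pi / 2).
  by rewrite (travelS w l) -natr1; field; rewrite wl.
have -> : pi / 2 * travel w l.+1 / w l.+2 -
    (pi / 2 * travel w l.+1 / w l.+2 - pi / 2 * l.+1%:R) = l.+1%:R * (pi / 2).
  by field; rewrite wl'.
have := quarter_turn_zero R l.+1.
case: (boolP (odd l.+1)) => [od|ev] => ->.
  by rewrite !mulr0 !mulrA (sodd _ od).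
by rewrite !mulr0 (seven _ ev).
Qed.

Theorem lemma4p3 (R : realType) (cmin cmax q : R)
    (hcmin : 0 < cmin) (hcmax : cmin < cmax)
    (hq0 : 0 < q) (hq : q <= (cmax - cmin) / (cmax + cmin)) :
  exists qmin C1 C2 : R, [/\ 0 < qmin, 0 < C1, 0 < C2 &
    forall n : nat, (1 <= n)%N ->
    exists (omega : R) (c : wave_speed R n),
      [/\ 0 < omega,
          forall l : nat, (1 <= l <= n.+1)%N -> cmin <= value c l <= cmax,
          localisation_interference qmin c omega,
          C1 <= omega / n%:R <= C2
        & system_mx c omega \in unitmx /\
          (* rows and columns of matrices are numbered from 0 *)
          forall (l : nat) (i j : 'I_(2 * n)), (1 <= l <= n)%N ->
            i.+1 = (2 * l - 1)%N -> j.+1 = (2 * n)%N ->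
            `|green_mx c omega i j| =
              (((1 + q) / (1 - q)) ^+ (uphalf n - l./2))%:C]].
Proof.
have hsum : 0 < cmax + cmin by rewrite addr_gt0 // (lt_trans hcmin).
have hq' : q * (cmax + cmin) <= cmax - cmin by rewrite -ler_pdivlMr.
have q1 : 0 < 1 - q.
  rewrite subr_gt0 (le_lt_trans hq) // ltr_pdivrMr // mul1r ltrD2l.
  by rewrite (lt_trans _ hcmin) // oppr_lt0.
(* [rho] solves (rho - 1) / (rho + 1) = q, and the upper bound on q amounts to rho cmin <= cmax. *)
set rho := (1 + q) / (1 - q).
have rho_gt0 : 0 < rho by rewrite divr_gt0 // addr_gt0.
have rho_ge1 : 1 <= rho by rewrite ler_pdivlMr // mul1r; lra.
have rho_cmax : rho * cmin <= cmax by rewrite mulrAC ler_pdivrMr //; lra.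
have jumpE : (rho * cmin - cmin) / (rho * cmin + cmin) = q.
  rewrite /rho; field; rewrite !gt_eqF //.
  by rewrite addr_gt0 // mulr_gt0 // addr_gt0.

have pi0 : 0 < pi / 2 :> R by rewrite divr_gt0 ?pi_gt0.
(* The lower value comes first, so that q_1 > 0 as the sign pattern demands. *)
pose w l := if odd l then cmin else rho * cmin.
have wb l : cmin <= w l <= cmax.
  rewrite /w; case: ifP => _; first by rewrite lexx ltW.
  by rewrite rho_cmax ler_peMl // ltW.
have w0 l : 0 < w l by have /andP[+ _] := wb l; apply: lt_le_trans.
pose s l := rho ^- l./2.
(* The frequency is pi / 2 times a sum of n + 1 values in [cmin, cmax]; the constants follow from n
   <= n + 1 <= 2 n. *)
exists q, (pi / 2 * cmin), (pi * cmax).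
split=> // [||n n1]; [by rewrite mulr_gt0 | by rewrite mulr_gt0 ?pi_gt0 // (lt_trans hcmin) |].
exists (quarter_frequency n w), (quarter_wave n w0).
have om0 : 0 < quarter_frequency n w by rewrite mulr_gt0 ?travel_gt0.
have jE l : (0 < l)%N -> jump (quarter_wave n w0) l = (-1) ^+ l.-1 * q.
  case: l => // l _; rewrite /jump /= /w /= negbK.
  rewrite -signr_odd; case: (odd l) => /=; last by rewrite expr0 mul1r jumpE.
  by rewrite expr1 mulN1r -jumpE -[in RHS]mulNr opprB [cmin + rho * _]addrC.
have M : matched (quarter_wave n w0) (quarter_frequency n w) s
    (fun l => pi / 2 * travel w l.-1 / w l - pi / 2 * l.-1%:R).
  apply: quarter_wave_matched => l ol.
    rewrite /w /s /= ol /= uphalf_half ol add1n exprS invfM.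
    by field; rewrite !gt_eqF ?exprn_gt0.
  by rewrite /s /= uphalf_half (negbTE ol).
have b1 : pi / 2 * travel w 0 / w 1%N - pi / 2 * 0%:R = 0.
  by rewrite /travel big_ord0 !mulr0 mul0r subr0.
have s1 : s 1%N = 1 by rewrite /s expr0 invr1.
have sn : s n.+1 != 0 by rewrite /s invr_eq0 expf_neq0 // gt_eqF.
split=> //.
- split=> [l /andP[l1 _]|l /andP[l1 _]|l /andP[l1 _]].
  + by rewrite jE // normrM normrX normrN1 expr1n mul1r gtr0_norm.
  + by rewrite jE // normrM normrX normrN1 expr1n mul1r gtr0_norm.
  (* Every layer has omega h_l / c_l = pi / 2, so the exponential is always -i. *)
  + right; rewrite quarter_wave_layer // /expi cosN sinN cos_pihalf sin_pihalf.
    by apply/eqP; rewrite eq_complex /= oppr0 !eqxx.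
- have n0 : 0 < n%:R :> R by rewrite ltr0n.
  have /andP[ta tb] := travel_bounds n.+1 wb.
  rewrite ler_pdivlMr // ler_pdivrMr // /quarter_frequency; apply/andP; split.
    by rewrite -[leLHS]mulrA ler_pM2l // (le_trans _ ta) // ler_pM2l // ler_nat.
  have -> : pi * cmax * n%:R = pi / 2 * (cmax * (n%:R + n%:R)) by field.
  rewrite ler_pM2l // (le_trans tb) // ler_pM2l ?(lt_trans hcmin) //.
  by rewrite -natrD ler_nat -addn1 leq_add2l.
- split=> [|l i j ln il jn]; first exact: (system_mx_unit om0 M b1 s1 sn).
  (* Row 2 l - 1 counted from 1 has index 2 (l - 1) counted from 0, the position of y_l. *)
  have il' : i = l.-1.*2 :> nat.
    by move: il; case: l ln => // l _; rewrite (mul2n l.+1) doubleS subn1 => -[].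
  rewrite (green_mx_last_col om0 M b1 s1 sn ln il' jn) /s.
  (* This keeps the natural-number subtraction in the exponent from truncating; [uphalf n], the
     ceiling of n / 2, is [n.+1./2]. *)
  have ll : (l./2 <= uphalf n)%N.
    case/andP: ln => _ /half_leq ln.
    by rewrite (leq_trans ln) // uphalf_half leq_addl.
  have -> : rho ^- l./2 / rho ^- n.+1./2 = rho ^+ (uphalf n - l./2).
    rewrite invrK mulrC -[n.+1./2]/(uphalf n) -{1}(subnK ll) exprD mulfK //.
    by rewrite expf_neq0 // gt_eqF.
  by rewrite ger0_norm // exprn_ge0 // ltW.
Qed.
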